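(* Let $s\in\mathbb{C}^n$ be the vector of all nominal complex powers $s_v$, including $s_0:=-\sum_{v\in V\setminus\{0\}}s_v$. Let the currents $i=i(U_N)\in\mathbb{C}^n$ and the voltages $u=u(U_N)\in\mathbb{C}^n$ be the functions of the nominal voltage $U_N$ determined by the equations $$u=Xi+U_Ne^{j\phi}\mathbf{1},\qquad \mathbf{1}^Ti=0,\qquad u_v\bar i_v=s_v\left|\frac{u_v}{U_N}\right|^{\eta_v}\ \ \forall v\in V\setminus\{0\}.$$ Then for all $v\in V$ we have that $$i_v(U_N)=e^{j\phi}\left(\frac{\bar s_v}{U_N}+\frac{c_v(U_N)}{U_N^2}\right),\qquad u_v(U_N)=e^{j\phi}\left(U_N+\frac{[X\bar s]_v}{U_N}+\frac{d_v(U_N)}{U_N^2}\right)$$ for some complex-valued functions $c_v(U_N)$ and $d_v(U_N)$ which are $O(1)$ as $U_N\to\infty$, i.e. they are bounded functions for large values of the nominal voltage $U_N$.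
   Context: $j$ is the imaginary unit and bar denotes (elementwise) complex conjugation. A microgrid in sinusoidal steady state is modelled by a finite directed graph $G$ with node set $V$, $|V|=n$, a distinguished node $0\in V$ (the point of common coupling, held at voltage $U_Ne^{j\phi}$ with $\phi$ arbitrary but fixed), and edge set $E$ (the power lines), where each $e\in E$ goes from a source node $\sigma(e)$ to a terminal node $\tau(e)$; $G$ is connected (irrespective of edge orientation). $A\in\{0,\pm1\}^{|E|\times n}$ is the incidence matrix: $[A]_{ev}=-1$ if $v=\sigma(e)$, $1$ if $v=\tau(e)$, $0$ otherwise. $z_e\in\mathbb{C}$ is the impedance of the power line $e$, $Z=\mathrm{diag}(z_e,\,e\in E)$ and $L=A^TZ^{-1}A\in\mathbb{C}^{n\times n}$. $\mathbf{1}$ is the all-ones vector and $\mathbf{1}_0$ the canonical basis vector of node $0$. $X\in\mathbb{C}^{n\times n}$ is the unique symmetric matrix with $XL=I-\mathbf{1}\mathbf{1}_0^T$ and $X\mathbf{1}_0=0$. For $v\neq0$, $s_v\in\mathbb{C}$ is the nominal complex power of node $v$ and $\eta_v$ is a characteristic parameter of node $v$ (for example $\eta_v=0,1,2$ for constant power, constant current and constant impedance devices, respectively). $i_v$ is the current injected by node $v$ and $u_v$ the voltage at node $v$.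
   Formalization: The equations can have several solutions (e.g. low-voltage ones), so i and u are taken on the branch where, for large U_N, all |u_v| lie between two positive multiples of U_N; this branch is shown to exist, to be unique for large U_N, and to have the stated expansion. *)

(* Defs.v *)
From HB Require Import structures.
From mathcomp Require Import all_boot all_order all_algebra.
From mathcomp Require Import all_classical all_reals all_analysis.
From mathcomp Require Export complex.

Set Implicit Arguments.
Unset Strict Implicit.
Unset Printing Implicit Defensive.

Import Order.TTheory GRing.Theory Num.Theory.
Import numFieldNormedType.Exports.

Local Open Scope classical_set_scope.
Local Open Scope ring_scope.
Local Open Scope complex_scope.

(* Complex modulus, as an element of R (the norm `|z| of R[i] is an element
   of R[i]). *)
Notation cmod := ComplexField.Normc.normc.

Definition expj (R : realType) (phi : R) : R[i] := cos phi +i* sin phi.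

(* Nodes are 'I_n and edges are 'I_m; edge e goes from src e to tgt e. *)

Definition connected_graph (n m : nat) (src tgt : 'I_m -> 'I_n) : Prop :=
  forall x y : 'I_n,
    connect (fun a b : 'I_n =>
      [exists e : 'I_m, ((src e == a) && (tgt e == b))
                     || ((src e == b) && (tgt e == a))]) x y.

Definition incidence_mx (R : realType) (n m : nat) (src tgt : 'I_m -> 'I_n)
  : 'M[R[i]]_(m, n) :=
  \matrix_(e < m, v < n)
    (if v == src e then -1 else if v == tgt e then 1 else 0).

Definition laplacian_mx (R : realType) (n m : nat) (src tgt : 'I_m -> 'I_n)
    (z : 'I_m -> R[i]) : 'M[R[i]]_n :=
  let A := incidence_mx R src tgt in
  A^T *m invmx (diag_mx (\row_(e < m) z e)) *m A.

Definition ones (R : realType) (n : nat) : 'cV[R[i]]_n := const_mx 1.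

Definition basis_vec (R : realType) (n : nat) (v : 'I_n) : 'cV[R[i]]_n :=
  delta_mx v 0.

Definition is_green_mx (R : realType) (n : nat) (pcc : 'I_n)
    (L X : 'M[R[i]]_n) : Prop :=
  [/\ X^T = X,
      X *m L = 1%:M - ones R n *m (basis_vec R pcc)^T &
      X *m basis_vec R pcc = 0].

(* The steady-state equations at nominal voltage U.  The entries s_pcc and
   eta_pcc are not constrained by them. *)
Definition grid_eqs (R : realType) (n : nat) (pcc : 'I_n) (X : 'M[R[i]]_n)
    (s : 'cV[R[i]]_n) (eta : 'I_n -> R) (phi U : R) (i u : 'cV[R[i]]_n)
  : Prop :=
  [/\ u = X *m i + (U%:C * expj phi) *: ones R n,
      (ones R n)^T *m i = 0 &
      forall v : 'I_n, v != pcc ->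
        u v 0 * conjc (i v 0) = s v 0 * (cmod (u v 0 / U%:C) `^ eta v)%:C].

(* At a fixed U the equations may have several solutions: with eta = 0 there
   are solutions whose voltages collapse as U grows, with eta > 2 solutions
   whose voltages grow faster than U.  The currents and voltages "determined
   by the equations" are those of the operating branch, on which all node
   voltages stay comparable to U.  Any solution of the form
   u_v = expj phi * (U + O(1/U)) satisfies this. *)
Definition operating_solution (R : realType) (n : nat) (pcc : 'I_n)
    (X : 'M[R[i]]_n) (s : 'cV[R[i]]_n) (eta : 'I_n -> R) (phi : R)
    (i u : R -> 'cV[R[i]]_n) : Prop :=
  (\forall U \near +oo, grid_eqs pcc X s eta phi U (i U) (u U)) /\
  (exists k K : R, 0 < k /\
    \forall U \near +oo, forall v : 'I_n,
      k * U <= cmod (u U v 0) <= K * U).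

Definition bigO1_at_infty (R : realType) (f : R -> R[i]) : Prop :=
  exists M : R, \forall U \near +oo, cmod (f U) <= M.

(* Main.v *)
(** In the normalized voltages w_v = u_v / (U e^(j phi)), the steady-state
    equations become the fixed-point problem
      w = 1 + U^-2 * F(w),   F(w)_v = sum_k X_vk (s_k)^* |w_k|^(eta_k - 2) w_k,
    because a device of power s_k |w_k|^eta_k injects the current
      (e^(j phi) / U) (s_k)^* |w_k|^(eta_k - 2) w_k.
    On an operating branch |w| stays in a fixed annulus, where F is bounded,
    hence w = 1 + O(U^-2).  On the ball |w - 1| <= 1/2 the map is a contraction
    for large U, which gives existence and uniqueness; replacing F(w) by
    F(1) = X s^* costs a factor O(U^-2), which gives the expansions. *)

From HB Require Import structures.
Require Import Defs.
From mathcomp Require Import all_boot all_order all_algebra.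
From mathcomp Require Import all_classical all_reals all_analysis.
From mathcomp Require Import ring lra.

Import Order.TTheory GRing.Theory Num.Theory.
Import numFieldNormedType.Exports.

Local Open Scope classical_set_scope.
Local Open Scope ring_scope.
Local Open Scope complex_scope.

(** * Modulus and conjugation of complex numbers *)

Section ComplexModulus.
Context {R : realType}.
Implicit Types x y : R[i].

Lemma cmod_ge0 x : 0 <= cmod x.
Proof. by case: x => a b; exact: sqrtr_ge0. Qed.

Lemma cmodC (a : R) : cmod a%:C = `|a|.
Proof. by rewrite /cmod /= expr0n /= addr0 sqrtr_sqr. Qed.

Lemma cmodN x : cmod (- x) = cmod x.
Proof. exact: normcN. Qed.

Lemma cmod_distC x y : cmod (x - y) = cmod (y - x).
Proof. by rewrite -cmodN opprB. Qed.

Lemma cmodD x y : cmod (x + y) <= cmod x + cmod y.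
Proof. exact: le_normcD. Qed.

Lemma cmod_dist x y : `|cmod x - cmod y| <= cmod (x - y).
Proof.
have h (a b : R[i]) : cmod a - cmod b <= cmod (a - b).
  by rewrite lerBlDr; have := cmodD (a - b) b; rewrite subrK.
by rewrite ler_norml h andbT lerNl opprB cmod_distC h.
Qed.

Lemma cmod_sum (I : finType) (P : pred I) (F : I -> R[i]) :
  cmod (\sum_(j | P j) F j) <= \sum_(j | P j) cmod (F j).
Proof.
elim/big_ind2: _ => [|a r b t ha hb|//]; first by rewrite Normc.normc0.
by rewrite (le_trans (cmodD _ _))// lerD.
Qed.

Lemma cmod_conjc x : cmod (conjc x) = cmod x.
Proof. by case: x => a b; rewrite /cmod /= sqrrN. Qed.

Lemma conjcM x y : conjc (x * y) = conjc x * conjc y.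
Proof. exact: rmorphM. Qed.

Lemma mulc_conj x : x * conjc x = (cmod x ^+ 2)%:C.
Proof.
case: x => a b; rewrite /cmod sqr_sqrtr ?addr_ge0 ?sqr_ge0//.
by apply/eqP; rewrite eq_complex /=; apply/andP; split; apply/eqP; ring.
Qed.

Lemma Re_le_cmod x : `|complex.Re x| <= cmod x.
Proof.
case: x => a b /=; rewrite -sqrtr_sqr ler_sqrt ?addr_ge0 ?sqr_ge0//.
by rewrite lerDl sqr_ge0.
Qed.

Lemma Im_le_cmod x : `|complex.Im x| <= cmod x.
Proof.
case: x => a b /=; rewrite -sqrtr_sqr ler_sqrt ?addr_ge0 ?sqr_ge0//.
by rewrite lerDr sqr_ge0.
Qed.

Lemma cmod_le_ReIm x : cmod x <= `|complex.Re x| + `|complex.Im x|.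
Proof.
case: x => a b /=; rewrite -[leRHS]ger0_norm ?addr_ge0// -sqrtr_sqr.
rewrite ler_sqrt ?sqr_ge0// sqrrD !real_normK ?num_real// addrAC lerDl.
by rewrite mulrn_wge0// mulr_ge0.
Qed.

Lemma cmod_expj (phi : R) : cmod (expj phi) = 1.
Proof. by rewrite /cmod /= cos2Dsin2 sqrtr1. Qed.

Lemma expj_neq0 (phi : R) : expj phi != 0.
Proof.
apply/eqP => e; have /eqP := cmod_expj phi.
by rewrite e Normc.normc0 eq_sym oner_eq0.
Qed.

Lemma expj_conj (phi : R) : expj phi * conjc (expj phi) = 1.
Proof. by rewrite mulc_conj cmod_expj expr1n. Qed.

End ComplexModulus.

(** * Real powers on an interval bounded away from zero *)

Section PowerBounds.
Context {R : realType}.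

(** The power is increasing for [p >= 0] and decreasing for [p < 0]; adding both endpoint values
    gives one bound valid for either sign. *)
Lemma powR_le_itv (p a b x : R) :
  0 < a -> a <= x <= b -> x `^ p <= a `^ p + b `^ p.
Proof.
move=> a0 /andP[ax xb]; have x0 := lt_le_trans a0 ax.
have b0 := lt_le_trans x0 xb.
have [p0|p0] := leP 0 p.
  by rewrite ler_wpDl ?powR_ge0// ge0_ler_powR// nnegrE ltW.
rewrite ler_wpDr ?powR_ge0// -(opprK p) !(powRN _ (- p)).
by rewrite lef_pV2 ?posrE ?powR_gt0// ge0_ler_powR ?nnegrE ?oppr_ge0// ltW.
Qed.

Lemma powR_lipschitz_itv (p a b : R) : 0 < a ->
  exists2 C, 0 <= C & forall x y, a <= x <= b -> a <= y <= b ->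
    `|x `^ p - y `^ p| <= C * `|x - y|.
Proof.
move=> a0; pose C := `|p| * (a `^ (p - 1) + b `^ (p - 1)).
exists C; first by rewrite mulr_ge0// addr_ge0 ?powR_ge0.
move=> x y; wlog yx : x y / y <= x.
  move=> wl hx hy; have [/wl->//|/ltW/wl h] := leP y x.
  by rewrite distrC (distrC x) h.
move=> /andP[ax xb] /andP[ay yb].
have y0 := lt_le_trans a0 ay.
have [||c /[!in_itv]/= /andP[yc cx] ->] :=
  @MVT_segment _ (@powR R ^~ p) (fun x => p * x `^ (p - 1)) y x yx.
- move=> t /[!in_itv]/= /andP[yt _].
  exact: (is_derive1_powR p (lt_trans y0 yt)).
- apply: continuous_in_subspaceT => t /set_mem /= /[!in_itv]/= /andP[yt _].
  apply: differentiable_continuous; apply/derivable1_diffP.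
  by have [] := is_derive1_powR p (lt_le_trans y0 yt).
rewrite normrM ler_wpM2r// normrM ler_wpM2l// ger0_norm ?powR_ge0//.
by apply: powR_le_itv => //; rewrite (le_trans ay yc) (le_trans cx xb).
Qed.

End PowerBounds.

(** * The nonlinear current response of a device on an annulus *)

Section Gain.
Context {R : realType}.

(* The current response [|w|^p / conj w], written without a division. *)
Definition gain (p : R) (w : R[i]) : R[i] := (cmod w `^ (p - 2))%:C * w.

Lemma gain1 (p : R) : gain p 1 = 1.
Proof. by rewrite /gain Normc.normc1 powR1 mulr1. Qed.

Lemma gain_bounded (p a b : R) : 0 < a ->
  exists2 C, 0 <= C & forall w, a <= cmod w <= b -> cmod (gain p w) <= C.
Proof.
move=> a0; exists ((a `^ (p - 2) + b `^ (p - 2)) * `|b|).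
  by rewrite mulr_ge0// addr_ge0 ?powR_ge0.
move=> w /andP[aw wb]; rewrite Normc.normcM cmodC ger0_norm ?powR_ge0//.
rewrite ler_pM ?powR_ge0 ?cmod_ge0 ?powR_le_itv ?aw//.
by rewrite (le_trans wb) ?ler_norm.
Qed.

(** Product rule: vary the vector with the scalar factor fixed, then the scalar factor. Writing
    [|b|] keeps the constant nonnegative whatever the sign of [b]. *)
Lemma gain_lipschitz (p a b : R) : 0 < a ->
  exists2 C, 0 <= C & forall w w', a <= cmod w <= b -> a <= cmod w' <= b ->
    cmod (gain p w - gain p w') <= C * cmod (w - w').
Proof.
move=> a0; have [L L0 hL] := powR_lipschitz_itv (p - 2) a b a0.
exists (a `^ (p - 2) + b `^ (p - 2) + L * `|b|).
  by rewrite !addr_ge0 ?powR_ge0 ?mulr_ge0.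
move=> w w' hw hw'.
have -> : gain p w - gain p w' = (cmod w `^ (p - 2))%:C * (w - w') +
    (cmod w `^ (p - 2) - cmod w' `^ (p - 2))%:C * w'.
  by rewrite /gain rmorphB /=; ring.
rewrite (le_trans (cmodD _ _))// mulrDl lerD// Normc.normcM cmodC.
  by rewrite ler_wpM2r ?cmod_ge0// ger0_norm ?powR_ge0// powR_le_itv.
rewrite mulrAC; apply: ler_pM => //; rewrite ?cmod_ge0//.
  by rewrite (le_trans (hL _ _ hw hw'))// ler_wpM2l// cmod_dist.
by case/andP: hw' => _ /le_trans; apply; exact: ler_norm.
Qed.

(** The exponents [eta] vary with the node, hence so do the constants; their sum over the finite
    index set serves all nodes at once. *)
Lemma uniform_constant (I : finType) (P : I -> R -> Prop) :
  (forall j C C', C <= C' -> P j C -> P j C') ->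
  (forall j, exists2 C, 0 <= C & P j C) ->
  exists2 C, 0 <= C & forall j, P j C.
Proof.
move=> mono hP; have [|f hf] := @boolp.choice _ _ (fun j C => 0 <= C /\ P j C).
  by move=> j; have [C C0 hC] := hP j; exists C.
exists (\sum_j f j); first by apply: sumr_ge0 => j _; case: (hf j).
move=> j; apply: mono (hf j).2; rewrite (bigD1 j)//= lerDl.
by apply: sumr_ge0 => k _; case: (hf k).
Qed.

End Gain.

(* The library has the complete and the normed structures on matrices, but
   not their join. *)
HB.instance Definition _ (R : realType) (m n : nat) :=
  Complete.on 'M[R]_(m.+1, n.+1).

(** * Banach's fixed-point theorem for finite families of complex numbers *)

Section FixedPoint.
Context {R : realType}.

Lemma mx_norm_leP (m n : nat) (A : 'M[R]_(m.+1, n.+1)) (x : R) : 0 <= x ->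
  (`|A| <= x) <-> (forall i j, `|A i j| <= x).
Proof.
move=> x0; rewrite -[`|A|]/(mx_norm A) mx_normrE; split.
  move=> /bigmax_leP[_ h] i j; exact: (h (i, j)).
by move=> h; apply/bigmax_leP; split => // -[i j] _; exact: h.
Qed.

(* The radius doubles because the matrix of real and imaginary parts carries
   the max norm, which is only comparable to the moduli. *)
Lemma contraction_cfamily (n : nat) (c : 'I_n -> R[i])
    (T : ('I_n -> R[i]) -> 'I_n -> R[i]) (r : R) : 0 <= r ->
  (forall w, (forall v, cmod (w v - c v) <= r + r) ->
     forall v, cmod (T w v - c v) <= r) ->
  (forall w w' D, (forall v, cmod (w v - c v) <= r + r) ->
     (forall v, cmod (w' v - c v) <= r + r) ->
     (forall v, cmod (w v - w' v) <= D) ->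
     forall v, cmod (T w v - T w' v) <= D / 4) ->
  exists w, (forall v, cmod (w v - c v) <= r + r) /\ forall v, w v = T w v.
Proof.
(* The empty family is treated apart, because the matrix norm is used in nonzero dimensions. *)
case: n c T => [c T _ _ _|n c T r0 self lip].
  by exists (fun=> 0); split=> -[].
pose dec (A : 'M[R]_(n.+1, 2)) (v : 'I_n.+1) : R[i] := A v 0 +i* A v 1.
pose enc (w : 'I_n.+1 -> R[i]) : 'M[R]_(n.+1, 2) :=
  \matrix_(v, j) if j == 0 then complex.Re (w v) else complex.Im (w v).
have encK w v : dec (enc w) v = w v by rewrite /dec /enc !mxE; case: (w v).
have enc_le w w' x : 0 <= x -> (forall v, cmod (w v - w' v) <= x) ->
    `|enc w - enc w'| <= x.
  move=> x0 h; apply/mx_norm_leP => // v j; rewrite !mxE.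
  have hv := h v; case: (j == 0); apply: le_trans hv.
    by have := Re_le_cmod (w v - w' v); rewrite raddfB.
  by have := Im_le_cmod (w v - w' v); rewrite raddfB.
have dec_le A B x : 0 <= x -> `|A - B| <= x ->
    forall v, cmod (dec A v - dec B v) <= x + x.
  move=> x0 /mx_norm_leP h v; apply: le_trans (cmod_le_ReIm _) _.
  have := h x0 v 0; have := h x0 v 1; rewrite !mxE => h1 h0.
  exact: lerD.
pose U := closed_ball_ Num.norm (enc c) r.
pose f A := enc (T (dec A)).
have Udec A : U A -> forall v, cmod (dec A v - c v) <= r + r.
  by move=> UA v; rewrite -(encK c) cmod_distC; exact: dec_le.
have fU : {homo f : x / U x >-> U x}.
  move=> A UA; rewrite /U /closed_ball_ /=; apply: enc_le => // v.
  by rewrite cmod_distC; apply: self; exact: Udec.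
pose F : {fun U >-> U} := HB.pack f (isFun.Build _ _ _ _ f fU).
have [|||p Up pE] := @banach_fixed_point _ _ U F.
(* Decoding at most doubles distances, [T] divides them by 4 and encoding does not increase them,
   whence the ratio 1/2. *)
- exists (2^-1)%:nng; split => /=; first by lra.
  move=> [A B] /= [UA UB]; apply: enc_le => [|v]; first exact: mulr_ge0.
  have h := @lip _ _ (`|A - B| + `|A - B|) (Udec _ UA) (Udec _ UB).
  apply: le_trans (h _ v) _; last by lra.
  by apply: dec_le.
- exact: closed_closed_ball_.
- by exists (enc c); rewrite /U /closed_ball_ /= subrr normr0.
exists (dec p); split; first exact: Udec.
by move=> v; rewrite {1}pE encK.
Qed.

End FixedPoint.

(** * The fixed-point map near the constant family 1 *)

Section Picard.
Context {R : realType} {n : nat} (M : 'M[R[i]]_n) (eta : 'I_n -> R).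
Implicit Types (w : 'I_n -> R[i]) (e : R).

(** In the application [e] is $U^{-2}$ and [M] has entries $X_{vk}\bar s_k$. *)
Definition picard e w (v : 'I_n) : R[i] :=
  1 + e%:C * \sum_k M v k * gain (eta k) (w k).

(** Summing the moduli of all entries, rather than those of row [v], makes the constant independent
    of [v]. *)
Lemma mx_entries_bound (v : 'I_n) (x : 'I_n -> R[i]) (B : R) :
  (forall k, cmod (x k) <= B) ->
  cmod (\sum_k M v k * x k) <= (\sum_j \sum_k cmod (M j k)) * B.
Proof.
move=> h; apply: le_trans (cmod_sum _ _ _) _.
have B0 : 0 <= B by exact: le_trans (cmod_ge0 _) (h v).
apply: (@le_trans _ _ ((\sum_k cmod (M v k)) * B)).
  rewrite mulr_suml; apply: ler_sum => k _.
  by rewrite Normc.normcM ler_wpM2l ?cmod_ge0.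
rewrite ler_wpM2r// [leRHS](bigD1 v)//= lerDl.
by apply: sumr_ge0 => j _; apply: sumr_ge0 => k _; exact: cmod_ge0.
Qed.

Let mass_ge0 : 0 <= \sum_j \sum_k cmod (M j k).
Proof. by do 2![apply: sumr_ge0 => ? _]; exact: cmod_ge0. Qed.

Lemma picard_bounded (a b : R) : 0 < a ->
  exists2 C, 0 <= C & forall e w, 0 <= e ->
    (forall v, a <= cmod (w v) <= b) ->
    forall v, cmod (picard e w v - 1) <= C * e.
Proof.
move=> a0.
have [||B B0 hB] := uniform_constant 'I_n (fun k C => forall x : R[i],
    a <= cmod x <= b -> cmod (gain (eta k) x) <= C).
- by move=> k C C' CC' h w /h /le_trans; apply.
- by move=> k; exact: gain_bounded.
exists ((\sum_j \sum_k cmod (M j k)) * B); first exact: mulr_ge0.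
move=> e w e0 hw v; rewrite /picard addrAC subrr add0r Normc.normcM cmodC.
rewrite ger0_norm// mulrC ler_wpM2r//.
by apply: mx_entries_bound => k; exact: hB.
Qed.

(** The constant 1 cancels and the gains are Lipschitz on the annulus. Since [C] does not depend on
    [e], small [e] gives a contraction in the sup distance. *)
Lemma picard_lipschitz (a b : R) : 0 < a ->
  exists2 C, 0 <= C & forall e w w' D, 0 <= e ->
    (forall v, a <= cmod (w v) <= b) -> (forall v, a <= cmod (w' v) <= b) ->
    (forall v, cmod (w v - w' v) <= D) ->
    forall v, cmod (picard e w v - picard e w' v) <= C * e * D.
Proof.
move=> a0.
have [||B B0 hB] := uniform_constant 'I_n (fun k C => forall x y : R[i],
    a <= cmod x <= b -> a <= cmod y <= b ->
    cmod (gain (eta k) x - gain (eta k) y) <= C * cmod (x - y)).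
- move=> k C C' CC' h w w' hw hw'; apply: le_trans (h w w' hw hw') _.
  by rewrite ler_wpM2r ?cmod_ge0.
- by move=> k; exact: gain_lipschitz.
exists ((\sum_j \sum_k cmod (M j k)) * B); first exact: mulr_ge0.
move=> e w w' D e0 hw hw' hD v.
have -> : picard e w v - picard e w' v =
    e%:C * \sum_k M v k * (gain (eta k) (w k) - gain (eta k) (w' k)).
  under eq_bigr do rewrite mulrBr.
  by rewrite sumrB /picard; ring.
rewrite Normc.normcM cmodC ger0_norm// mulrAC mulrC ler_wpM2r//.
rewrite -mulrA; apply: mx_entries_bound => k.
by apply: le_trans (hB _ _ _ (hw k) (hw' k)) _; rewrite ler_wpM2l.
Qed.

Lemma cmod_near1 (x : R[i]) :
  cmod (x - 1) <= 2^-1 -> 2^-1 <= cmod x <= 3 / 2.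
Proof.
move=> h; have := le_trans (cmod_dist x 1) h.
by rewrite Normc.normc1 ler_norml => /andP[h1 h2]; apply/andP; split; lra.
Qed.

(** Lipschitz bound against the value 1 of the gain at 1; this controls the error of replacing
    $F(w)$ by $F(1)$. *)
Lemma gain_near1 : exists2 C, 0 <= C & forall k (x : R[i]),
  cmod (x - 1) <= 2^-1 -> cmod (gain (eta k) x - 1) <= C * cmod (x - 1).
Proof.
apply: uniform_constant => [k C C' CC' h x /h /le_trans|k].
  by apply; rewrite ler_wpM2r ?cmod_ge0.
have [|C C0 hC] := gain_lipschitz (eta k) 2^-1 (3 / 2).
  by rewrite invr_gt0.
exists C => // x hx; rewrite -[in leLHS](gain1 (eta k)); apply: hC.
  exact: cmod_near1.
by apply: cmod_near1; rewrite subrr Normc.normc0 invr_ge0.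
Qed.

(** The value 1/4 is both the radius and the contraction factor used with [contraction_cfamily]. The
    [+ 1] in the witness covers [C = 0]. *)
Lemma small_factor (C : R) : 0 <= C ->
  exists2 e0, 0 < e0 & forall e, e <= e0 -> C * e <= 4^-1.
Proof.
move=> C0; exists (4 * (C + 1))^-1; first by rewrite invr_gt0; lra.
move=> e he; apply: le_trans (ler_wpM2l C0 he) _.
by rewrite ler_pdivrMr; lra.
Qed.

Lemma picard_fixed_point : exists2 e0, 0 < e0 & forall e, 0 <= e <= e0 ->
  exists w, (forall v, cmod (w v - 1) <= 2^-1) /\
    forall v, w v = picard e w v.
Proof.
have h2 : 0 < 2^-1 :> R by rewrite invr_gt0.
have [B B0 hB] := picard_bounded _ (3 / 2) h2.
have [C C0 hC] := picard_lipschitz _ (3 / 2) h2.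
have [e1 e1_gt0 he1] := small_factor _ B0.
have [e2 e2_gt0 he2] := small_factor _ C0.
exists (Num.min e1 e2); first by rewrite lt_min e1_gt0.
move=> e; rewrite le_min => /and3P[e0 ee1 ee2].
(* With radius 1/4 the doubled ball of [contraction_cfamily] is exactly the ball of radius 1/2. *)
have q : 4^-1 + 4^-1 = 2^-1 :> R by lra.
rewrite -q; apply: contraction_cfamily => [|w hw v|w w' D hw hw' hD v].
- by rewrite invr_ge0.
- apply: le_trans (he1 _ ee1); apply: hB => // k.
  by apply: cmod_near1; rewrite -q.
have D0 : 0 <= D by exact: le_trans (cmod_ge0 _) (hD v).
apply: (@le_trans _ _ (C * e * D)); last first.
  by rewrite [leRHS]mulrC ler_wpM2r ?he2.
by apply: hC => // k; apply: cmod_near1; rewrite -q.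
Qed.

Lemma picard_unique : exists2 e0, 0 < e0 & forall e, 0 <= e <= e0 ->
  forall w w',
  (forall v, cmod (w v - 1) <= 2^-1) -> (forall v, w v = picard e w v) ->
  (forall v, cmod (w' v - 1) <= 2^-1) -> (forall v, w' v = picard e w' v) ->
  forall v, w v = w' v.
Proof.
have h2 : 0 < 2^-1 :> R by rewrite invr_gt0.
have [C C0 hC] := picard_lipschitz _ (3 / 2) h2.
have [e2 e2_gt0 he2] := small_factor _ C0.
exists e2 => // e /andP[e0 ee2] w w' hw fw hw' fw' v.
pose d v := cmod (w v - w' v).
(* At a node of largest distance the contraction gives [d j <= d j / 4], so all distances vanish. *)
have [j _ jmax] := @arg_maxP _ R _ v xpredT d isT.
have dj : d j <= C * e * d j.
  rewrite {1}/d fw fw'; apply: hC => // k; last exact: jmax.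
    exact/cmod_near1/hw.
  exact/cmod_near1/hw'.
have {}dj : d j <= 0.
  have := cmod_ge0 (w j - w' j); rewrite -/(d j) => d0.
  have := ler_wpM2r d0 (he2 _ ee2); lra.
have dv : d v = 0.
  apply/eqP; rewrite eq_le (le_trans (jmax v isT) dj)/=; exact: cmod_ge0.
by apply/eqP; rewrite -subr_eq0; apply/eqP/Normc.eq0_normc.
Qed.

End Picard.

(** * Equivalence of the steady-state equations with the fixed-point problem *)

Section Reduction.
Context {R : realType} {n : nat} (pcc : 'I_n) (X : 'M[R[i]]_n)
  (s : 'cV[R[i]]_n) (eta : 'I_n -> R) (phi : R).
Implicit Types (U : R) (w : 'I_n -> R[i]).

Definition load_mx : 'M[R[i]]_n := \matrix_(v, k) (X v k * conjc (s k 0)).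

Definition device_current U w (v : 'I_n) : R[i] :=
  expj phi / U%:C * (conjc (s v 0) * gain (eta v) (w v)).

(** No device law holds at [pcc]; its current is forced by $\mathbf{1}^Ti=0$. *)
Definition grid_current U w : 'cV[R[i]]_n :=
  \col_v if v == pcc then - \sum_(k | k != pcc) device_current U w k
         else device_current U w v.

Definition normalized U (u : 'cV[R[i]]_n) (v : 'I_n) : R[i] :=
  u v 0 / (U%:C * expj phi).

(** The phase and [U] cancel, and $w\bar w=|w|^2$ raises the exponent $\eta_v-2$ to $\eta_v$. *)
Lemma device_power U w (v : 'I_n) : 0 < U -> w v != 0 ->
  U%:C * expj phi * w v * conjc (device_current U w v) =
  s v 0 * (cmod (w v) `^ eta v)%:C.
Proof.
move=> U0 w0; have U0' : U%:C != 0 :> R[i] by rewrite fmorph_eq0 gt_eqF.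
have c0 : cmod (w v) != 0 by apply: contra w0 => /eqP/Normc.eq0_normc ->.
rewrite /device_current /gain !conjcM conjc_inv conjcK !conjc_real.
transitivity (s v 0 * ((expj phi * conjc (expj phi)) *
    (cmod (w v) `^ (eta v - 2))%:C * (w v * conjc (w v)))); first by field.
rewrite expj_conj mul1r mulc_conj -rmorphM /=; congr (_ * _%:C).
rewrite powRB ?c0 ?implybT// powR_mulrn ?cmod_ge0// mulfVK//.
by rewrite expf_neq0.
Qed.

(** Column [pcc] of [X] vanishes, so the current at [pcc], which obeys no device law, drops out.
    Each other term has the factor $e^{j\phi}/U=Ue^{j\phi}U^{-2}$. *)
Lemma Xcurrent U w (i : 'cV[R[i]]_n) : 0 < U -> X *m basis_vec R pcc = 0 ->
  (forall v, v != pcc -> i v 0 = device_current U w v) ->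
  forall v, (X *m i) v 0 =
    U%:C * expj phi * (picard load_mx eta (U ^+ 2)^-1 w v - 1).
Proof.
move=> U0 X0 hi v; have U0' : U%:C != 0 :> R[i] by rewrite fmorph_eq0 gt_eqF.
have Xpcc : X v pcc = 0.
  by have /matrixP/(_ v 0) := X0; rewrite /basis_vec -colE !mxE.
rewrite /picard addrAC subrr add0r mulrA mulr_sumr mxE.
apply: eq_bigr => k _; rewrite mxE.
have [->|kp] := eqVneq k pcc; first by rewrite Xpcc !(mul0r, mulr0).
rewrite hi// /device_current fmorphV rmorphXn /=; field.
exact: U0'.
Qed.

(** Nonzero voltages let the power equations be solved for the device currents. The balance then
    fixes the current at [pcc], and the voltage equation becomes the fixed-point equation. *)
Lemma grid_eqsP U (i u : 'cV[R[i]]_n) : 0 < U ->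
  X *m basis_vec R pcc = 0 -> (forall v, u v 0 != 0) ->
  grid_eqs pcc X s eta phi U i u <->
  i = grid_current U (normalized U u) /\
  forall v, normalized U u v =
    picard load_mx eta (U ^+ 2)^-1 (normalized U u) v.
Proof.
move=> U0 X0 u0; have U0' : U%:C != 0 :> R[i] by rewrite fmorph_eq0 gt_eqF.
set w := normalized U u.
have Ue0 : U%:C * expj phi != 0 by rewrite mulf_neq0// expj_neq0.
have uE v : u v 0 = U%:C * expj phi * w v.
  by rewrite /w /normalized mulrC divfK.
have w0 v : w v != 0 by have := u0 v; rewrite uE mulf_eq0 negb_or => /andP[].
have cw v : cmod (u v 0 / U%:C) = cmod (w v).
  have -> : u v 0 / U%:C = expj phi * w v by rewrite uE; field.
  by rewrite Normc.normcM cmod_expj mul1r.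
have sumE (j : 'cV[R[i]]_n) :
    ((ones R n)^T *m j) 0 0 = j pcc 0 + \sum_(k | k != pcc) j k 0.
  rewrite mxE (bigD1 pcc)//= !mxE mul1r; congr (_ + _).
  by apply: eq_bigr => k _; rewrite !mxE mul1r.
have XE (j : 'cV[R[i]]_n) :
    (forall v, v != pcc -> j v 0 = device_current U w v) ->
    (forall v, w v = picard load_mx eta (U ^+ 2)^-1 w v) <->
    u = X *m j + (U%:C * expj phi) *: ones R n.
  move=> hj; have XjE := @Xcurrent U w j U0 X0 hj; split => [fw|uX v].
    apply/colP => v; rewrite mxE XjE uE !mxE -fw; ring.
  apply: (mulfI Ue0); rewrite -uE uX mxE XjE !mxE; ring.
split=> [[eu sum0 pw]|[iE fw]].
  have hi v : v != pcc -> i v 0 = device_current U w v.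
    move=> vp; apply: (can_inj (@conjcK R)); apply: (mulfI (u0 v)).
    by rewrite (pw v vp) cw [in RHS]uE device_power.
  split; last exact/(XE i hi).
  apply/colP => v; rewrite mxE; case: eqVneq => [->|/hi//].
  have /matrixP/(_ 0 0) := sum0; rewrite sumE mxE => /eqP.
  by rewrite addr_eq0 => /eqP ->; congr (- _); exact: eq_bigr.
have hi v : v != pcc -> i v 0 = device_current U w v.
  by move=> /negPf vp; rewrite iE mxE vp.
split; first exact/(XE i hi).
  apply/matrixP => a b; rewrite !ord1 sumE mxE iE mxE eqxx.
  rewrite -[X in _ + X]/(\sum_(k | k != pcc) _) addrC; apply/eqP.
  rewrite subr_eq0; apply/eqP/eq_bigr => k /negPf kp; by rewrite mxE kp.
by move=> v vp; rewrite cw hi// [X in X * _]uE device_power.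
Qed.

End Reduction.

(** * Existence, uniqueness and expansion of the operating branch *)

Section OperatingBranch.
Context {R : realType} {n : nat} (pcc : 'I_n) (X : 'M[R[i]]_n)
  (s : 'cV[R[i]]_n) (eta : 'I_n -> R) (phi : R).
Context (X0 : X *m basis_vec R pcc = 0).

Lemma near_inv_sq (e0 : R) : 0 < e0 ->
  \forall U \near +oo, 1 <= U /\ (U ^+ 2)^-1 <= e0.
Proof.
move=> e0_gt0; near=> U.
have U1 : 1 <= U by near: U; exact: nbhs_pinfty_ge.
have Ue : e0^-1 <= U by near: U; apply: nbhs_pinfty_ge; rewrite num_real.
split=> //; rewrite -[e0]invrK lef_pV2 ?posrE ?invr_gt0 ?exprn_gt0//.
by rewrite (le_trans Ue)// expr2 ler_peMr// (le_trans ler01).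
Unshelve. all: by end_near. Qed.

Lemma cmod_normalized (U : R) (u : 'cV[R[i]]_n) (v : 'I_n) : 0 < U ->
  cmod (normalized phi U u v) = cmod (u v 0) / U.
Proof.
move=> U0; rewrite /normalized Normc.normcM Normc.normcV Normc.normcM.
by rewrite cmod_expj mulr1 cmodC gtr0_norm.
Qed.

(** Bootstrap: the branch condition only places [w] in the annulus between [k] and [K], but there
    [picard] is within [C * (U ^+ 2)^-1] of 1, and [w] equals its own image. *)
Lemma operating_solution_localized (i u : R -> 'cV[R[i]]_n) :
  operating_solution pcc X s eta phi i u ->
  exists2 C, 0 <= C & \forall U \near +oo,
    let w := normalized phi U (u U) in
    [/\ i U = grid_current pcc s eta phi U w,
        forall v, w v = picard (load_mx X s) eta (U ^+ 2)^-1 w v,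
        forall v, cmod (w v - 1) <= 2^-1 &
        forall v, cmod (w v - 1) <= C * (U ^+ 2)^-1].
Proof.
move=> [eqs [k [K [k0 uK]]]].
have [C C0 hC] := picard_bounded (load_mx X s) eta k K k0.
have [e0 e0_gt0 he0] := small_factor C C0.
exists C => //; near=> U; set w := normalized phi U (u U).
have [U1 Ue0] : 1 <= U /\ (U ^+ 2)^-1 <= e0 by near: U; exact: near_inv_sq.
have U0 : 0 < U := lt_le_trans ltr01 U1.
have hU v : k * U <= cmod (u U v 0) <= K * U by move: v; near: U.
have hw v : k <= cmod (w v) <= K.
  by rewrite cmod_normalized// ler_pdivlMr// ler_pdivrMr.
have u0 v : u U v 0 != 0.
  apply/eqP => uv; have := hU v; rewrite uv Normc.normc0 => /andP[+ _].
  by rewrite leNgt mulr_gt0.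
have geq : grid_eqs pcc X s eta phi U (i U) (u U) by near: U.
have [iE fw] := (grid_eqsP _ X s eta phi U _ _ U0 X0 u0).1 geq.
have hb v : cmod (w v - 1) <= C * (U ^+ 2)^-1.
  by rewrite {1}/w fw; apply: hC => //; rewrite invr_ge0 sqr_ge0.
split=> // v; apply: le_trans (hb v) (le_trans (he0 _ Ue0) _).
by rewrite lef_pV2 ?posrE// ler_nat.
Unshelve. all: by end_near. Qed.

Lemma operating_solution_exists :
  exists i u, operating_solution pcc X s eta phi i u.
Proof.
have [e0 e0_gt0 he0] := picard_fixed_point (load_mx X s) eta.
have [|W hW] := @boolp.choice R ('I_n -> R[i]) (fun e w => 0 <= e <= e0 ->
    (forall v, cmod (w v - 1) <= 2^-1) /\
    forall v, w v = picard (load_mx X s) eta e w v).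
  (* The zero family is a dummy value outside the range, which large [U] never meets. *)
  move=> e; have [he|he] := boolP (0 <= e <= e0); last by exists (fun=> 0).
  by have [w hw] := he0 _ he; exists w.
pose w U := W (U ^+ 2)^-1.
exists (fun U => grid_current pcc s eta phi U (w U)).
exists (fun U => \col_v (U%:C * expj phi * w U v)).
have main : \forall U \near +oo, 0 < U /\
    (forall v, cmod (w U v - 1) <= 2^-1) /\
    forall v, w U v = picard (load_mx X s) eta (U ^+ 2)^-1 (w U) v.
  near=> U.
  have [U1 Ue0] : 1 <= U /\ (U ^+ 2)^-1 <= e0 by near: U; exact: near_inv_sq.
  split; first exact: lt_le_trans U1.
  by apply: hW; rewrite invr_ge0 sqr_ge0 Ue0.
split.
  near=> U.
  have [U0 [w1 fw]] : 0 < U /\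
    (forall v, cmod (w U v - 1) <= 2^-1) /\
    forall v, w U v = picard (load_mx X s) eta (U ^+ 2)^-1 (w U) v by near: U.
  have Ue0 : U%:C * expj phi != 0.
    by rewrite mulf_neq0 ?expj_neq0// fmorph_eq0 gt_eqF.
  have wE : normalized phi U (\col_v (U%:C * expj phi * w U v)) = w U.
    by apply/funext => v; rewrite /normalized mxE mulrC mulKf.
  apply/grid_eqsP => //; last by rewrite wE.
  move=> v; rewrite mxE mulf_neq0//; apply/eqP => wv.
  have /andP[+ _] := cmod_near1 _ (w1 v).
  by rewrite wv Normc.normc0 leNgt invr_gt0 ltr0n.
exists 2^-1, (3 / 2); split; first by rewrite invr_gt0.
near=> U => v.
have [U0 [w1 fw]] : 0 < U /\
    (forall v, cmod (w U v - 1) <= 2^-1) /\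
    forall v, w U v = picard (load_mx X s) eta (U ^+ 2)^-1 (w U) v by near: U.
rewrite mxE !Normc.normcM cmod_expj mulr1 cmodC gtr0_norm// mulrC.
by rewrite !(mulrC U) !ler_pM2r//; exact: cmod_near1.
Unshelve. all: by end_near. Qed.

(** Localization brings both branches into the ball where the fixed point is unique; the normalized
    voltages then determine the currents. *)
Lemma operating_solution_unique (i u i' u' : R -> 'cV[R[i]]_n) :
  operating_solution pcc X s eta phi i u ->
  operating_solution pcc X s eta phi i' u' ->
  \forall U \near +oo, i U = i' U /\ u U = u' U.
Proof.
move=> /operating_solution_localized[C C0 h].
move=> /operating_solution_localized[C' C'0 h'].
have [e0 e0_gt0 he0] := picard_unique (load_mx X s) eta.
have hs := near_inv_sq e0 e0_gt0.
apply: filterS3 h h' hs => U [iE fw hw _] [iE' fw' hw' _] [U1 Ue0].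
have U0 : 0 < U := lt_le_trans ltr01 U1.
have ww' : normalized phi U (u U) = normalized phi U (u' U).
  by apply/funext/(he0 (U ^+ 2)^-1) => //; rewrite invr_ge0 sqr_ge0 Ue0.
split; first by rewrite iE iE' ww'.
have Ue : (U%:C * expj phi)^-1 != 0.
  by rewrite invr_eq0 mulf_neq0 ?expj_neq0// fmorph_eq0 gt_eqF.
by apply/colP => v; apply: (mulIf Ue); have /funeqP/(_ v) := ww'.
Qed.

Context (hs : s pcc 0 = - \sum_(v < n | v != pcc) s v 0).

Lemma grid_current_asymp : exists2 C, 0 <= C & forall U w v, 0 < U ->
  (forall k, cmod (w k - 1) <= 2^-1) -> forall D,
  (forall k, cmod (w k - 1) <= D) ->
  cmod (grid_current pcc s eta phi U w v 0 * U%:C / expj phi - conjc (s v 0))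
  <= C * D.
Proof.
have [L L0 hL] := gain_near1 eta.
pose S := \sum_k cmod (s k 0).
have S0 : 0 <= S by apply: sumr_ge0 => k _; exact: cmod_ge0.
exists (S * L); first exact: mulr_ge0.
move=> U w v U0 w1 D wD.
have U0' : U%:C != 0 :> R[i] by rewrite fmorph_eq0 gt_eqF.
have e0 := expj_neq0 phi.
pose r k := conjc (s k 0) * (gain (eta k) (w k) - 1).
have rE k : device_current s eta phi U w k * U%:C / expj phi =
    conjc (s k 0) + r k.
  by rewrite /device_current /r; field; apply/andP.
have D0 : 0 <= D by exact: le_trans (cmod_ge0 _) (wD v).
have rle k : cmod (r k) <= cmod (s k 0) * (L * D).
  rewrite Normc.normcM cmod_conjc ler_wpM2l ?cmod_ge0//.
  by rewrite (le_trans (hL _ _ (w1 k)))// ler_wpM2l.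
have LD0 : 0 <= L * D by exact: mulr_ge0.
(* At [pcc] the choice of $s_0$ in [hs] cancels the leading terms, leaving minus the sum of the
   device errors [r k]. *)
rewrite mxE; case: eqVneq => [->|vp].
  have -> : - (\sum_(k | k != pcc) device_current s eta phi U w k) * U%:C /
      expj phi - conjc (s pcc 0) = - \sum_(k | k != pcc) r k.
    have -> : conjc (s pcc 0) = - \sum_(k | k != pcc) conjc (s k 0).
      by rewrite hs raddfN raddf_sum.
    rewrite opprK !mulNr !mulr_suml.
    under eq_bigr do rewrite rE.
    by rewrite big_split /= opprD addrAC addNr add0r.
  rewrite cmodN (le_trans (cmod_sum _ _ _))// -mulrA mulr_suml.
  rewrite [leRHS](bigD1 pcc)//= ler_wpDl ?mulr_ge0 ?cmod_ge0//.
  exact: ler_sum.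
rewrite rE addrAC subrr add0r (le_trans (rle v))// -mulrA ler_wpM2r//.
rewrite /S (bigD1 v)//= lerDl.
by apply: sumr_ge0 => k _; exact: cmod_ge0.
Qed.

(** With all gains equal to 1 the sum is exactly $[X\bar s]_v$; the rest is bounded by
    [gain_near1]. *)
Lemma picard_asymp : exists2 C, 0 <= C & forall e w v, 0 <= e ->
  (forall k, cmod (w k - 1) <= 2^-1) -> forall D,
  (forall k, cmod (w k - 1) <= D) ->
  cmod (picard (load_mx X s) eta e w v - 1
        - e%:C * (X *m map_mx conjc s) v 0) <= C * D * e.
Proof.
have [L L0 hL] := gain_near1 eta.
exists ((\sum_j \sum_k cmod (load_mx X s j k)) * L).
  by rewrite mulr_ge0//; do 2![apply: sumr_ge0 => ? _]; exact: cmod_ge0.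
move=> e w v e0 w1 D wD.
have -> : picard (load_mx X s) eta e w v - 1
      - e%:C * (X *m map_mx conjc s) v 0 =
    e%:C * \sum_k load_mx X s v k * (gain (eta k) (w k) - 1).
  rewrite /picard; under [X in _ = _ * X]eq_bigr do rewrite mulrBr mulr1.
  rewrite sumrB (_ : (X *m _) v 0 = \sum_k load_mx X s v k); first by ring.
  by rewrite mxE; apply: eq_bigr => k _; rewrite !mxE.
rewrite Normc.normcM cmodC ger0_norm// mulrC ler_wpM2r// -mulrA.
apply: mx_entries_bound => k.
by rewrite (le_trans (hL _ _ (w1 k)))// ler_wpM2l.
Qed.

Lemma operating_solution_asymp (i u : R -> 'cV[R[i]]_n) :
  operating_solution pcc X s eta phi i u ->
  forall v : 'I_n, exists c d : R -> R[i],
    [/\ bigO1_at_infty c,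
        bigO1_at_infty d &
        forall U : R, 0 < U ->
          i U v 0 = expj phi * (conjc (s v 0) / U%:C + c U / U%:C ^+ 2) /\
          u U v 0 = expj phi * (U%:C
            + (X *m map_mx conjc s) v 0 / U%:C + d U / U%:C ^+ 2)].
Proof.
move=> /operating_solution_localized[C C0 hloc] v.
have e0 := expj_neq0 phi.
(* Both remainders are obtained by solving the expansions for them, so the identities hold for every
   [U > 0]; only boundedness uses the branch. *)
exists (fun U => U%:C * (i U v 0 * U%:C / expj phi - conjc (s v 0))).
exists (fun U => U%:C ^+ 3 * (normalized phi U (u U) v - 1
    - (U ^+ 2)^-1%:C * (X *m map_mx conjc s) v 0)).
have near1 := near_inv_sq 1 ltr01.
split.
(* The bracket is $O(U^{-2})$, so its product with [U] is at most [B * C] once [1 <= U]. *)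
- have [B B0 hB] := grid_current_asymp; exists (B * C).
  apply: filterS2 hloc near1 => U [iE _ w1 wC] [U1 _].
  have U0 : 0 < U := lt_le_trans ltr01 U1.
  rewrite Normc.normcM cmodC gtr0_norm// -ler_pdivlMl// iE.
  apply: le_trans (hB _ _ _ U0 w1 _ wC) _.
  rewrite mulrA mulrC ler_wpM2r ?mulr_ge0// lef_pV2 ?posrE ?exprn_gt0//.
  by rewrite expr2 ler_peMr// ltW.
(* Taking [D] as $CU^{-2}$ and [e] as $U^{-2}$ makes the error $O(U^{-4})$, which absorbs the factor
   $U^3$. *)
- have [B B0 hB] := picard_asymp; exists (B * C).
  apply: filterS2 hloc near1 => U [_ fw w1 wC] [U1 _].
  have U0 : 0 < U := lt_le_trans ltr01 U1.
  have e'0 : 0 <= (U ^+ 2)^-1 by rewrite invr_ge0 sqr_ge0.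
  rewrite fw Normc.normcM (_ : U%:C ^+ 3 = (U ^+ 3)%:C); last first.
    by rewrite rmorphXn.
  rewrite cmodC gtr0_norm ?exprn_gt0//.
  rewrite -ler_pdivlMl ?exprn_gt0//.
  apply: le_trans (hB _ _ v e'0 w1 _ wC) _.
  rewrite mulrA -mulrA mulrC ler_wpM2r ?mulr_ge0// -invfM.
  rewrite lef_pV2 ?posrE ?mulr_gt0 ?exprn_gt0// -exprD.
  by rewrite ler_weXn2l.
move=> U U0; have U0' : U%:C != 0 :> R[i] by rewrite fmorph_eq0 gt_eqF.
split; first by field; apply/andP.
by rewrite /normalized fmorphV rmorphXn /=; field; apply/andP.
Qed.

End OperatingBranch.

(** The first two conclusions give sense to functions determined by the equations: an operating
    branch exists, and any two agree for all large [U]. *)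
Theorem proposition2 (R : realType) (n m : nat) (src tgt : 'I_m -> 'I_n)
  (pcc : 'I_n) (z : 'I_m -> R[i]) (X : 'M[R[i]]_n)
  (s : 'cV[R[i]]_n) (eta : 'I_n -> R) (phi : R)
  (hconn : connected_graph src tgt)
  (hz : forall e : 'I_m, z e != 0)
  (hX : is_green_mx pcc (laplacian_mx src tgt z) X)
  (hs : s pcc 0 = - \sum_(v < n | v != pcc) s v 0) :
  [/\ exists i u : R -> 'cV[R[i]]_n,
        operating_solution pcc X s eta phi i u,
      forall i u i' u' : R -> 'cV[R[i]]_n,
        operating_solution pcc X s eta phi i u ->
        operating_solution pcc X s eta phi i' u' ->
        \forall U \near +oo, i U = i' U /\ u U = u' U &
      forall i u : R -> 'cV[R[i]]_n,
        operating_solution pcc X s eta phi i u ->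
        forall v : 'I_n, exists c d : R -> R[i],
          [/\ bigO1_at_infty c,
              bigO1_at_infty d &
              forall U : R, 0 < U ->
                i U v 0 = expj phi * (conjc (s v 0) / U%:C + c U / U%:C ^+ 2) /\
                u U v 0 = expj phi * (U%:C
                  + (X *m map_mx conjc s) v 0 / U%:C + d U / U%:C ^+ 2)]].
Proof.
have [_ _ X0] := hX; split.
- exact: operating_solution_exists.
- by move=> i u i' u'; exact: operating_solution_unique.
- by move=> i u; exact: operating_solution_asymp.
Qed.
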